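(* Let $\mathcal{A}$ be an abelian category and let $a,b\in\{1,2,3,\dots\}$. If $\mathcal{A}$ has enough projectives, then every object of $\mathcal{A}$, considered as an object of $\mathrm{Com}_{a+b}(\mathcal{A})$ concentrated in degree $0$, admits an $\mathrm{H}^{(a,b)}$-projective resolution in $\mathrm{Com}_{a+b}(\mathcal{A})$.
   Context: For $N\ge 1$, $\mathrm{Com}_N(\mathcal{A})$ is the category of $N$-complexes: families $C=(C_i)_{i\in\mathbb{Z}}$ of objects of $\mathcal{A}$ with morphisms $d_i:C_i\to C_{i+1}$ satisfying $d_{i+N-1}\cdots d_{i+1}d_i=0$ for all $i$ (written $d^N=0$); morphisms are families $f_i:C_i\to D_i$ commuting with the differentials. For an $(a+b)$-complex $C$ and $j\in\mathbb{Z}$, $\mathrm{H}^{(a,b)}_j(C)=\ker(d^a:C_j\to C_{j+a})/\operatorname{im}(d^b:C_{j-b}\to C_j)$. A morphism $f$ of $(a+b)$-complexes is an $\mathrm{H}^{(a,b)}$-quasi-isomorphism if $\mathrm{H}^{(a,b)}_j(f)$ is an isomorphism for all $j\in\mathbb{Z}$. An object $P\in\mathrm{Com}_{a+b}(\mathcal{A})$ is an $\mathrm{H}^{(a,b)}$-projective resolution of $X\in\mathcal{A}$ if $P_i=0$ for $i\ge 1$, $P_i$ is projective in $\mathcal{A}$ for $i\le 0$, and there is an $\mathrm{H}^{(a,b)}$-quasi-isomorphism from $P$ to the complex having $X$ in degree $0$ and $0$ in all other degrees. $\mathcal{A}$ has enough projectives if every object of $\mathcal{A}$ is a quotient of a projective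 object. *)

(* Defs.v *)
From HB Require Import structures.
From mathcomp Require Import all_boot all_order all_algebra.
From mathcomp Require Import boolp.

Set Implicit Arguments.
Unset Strict Implicit.
Unset Printing Implicit Defensive.

Import GRing.Theory.
Local Open Scope ring_scope.

Declare Scope cat_scope.
Delimit Scope cat_scope with cat.

Reserved Notation "g \oc f" (at level 40, left associativity).

Record preadditiveCat := PreadditiveCat {
  obj :> Type;
  hom : obj -> obj -> zmodType;
  idm : forall X, hom X X;
  comp : forall X Y Z, hom Y Z -> hom X Y -> hom X Z;
  compA : forall W X Y Z (h : hom Y Z) (g : hom X Y) (f : hom W X),
    comp h (comp g f) = comp (comp h g) f;
  comp1m : forall X Y (f : hom X Y), comp (idm Y) f = f;
  compm1 : forall X Y (f : hom X Y), comp f (idm X) = f;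
  compDl : forall X Y Z (g h : hom Y Z) (f : hom X Y),
    comp (g + h) f = comp g f + comp h f;
  compDr : forall X Y Z (g : hom Y Z) (f h : hom X Y),
    comp g (f + h) = comp g f + comp g h
}.

Arguments hom {p} X Y : rename.
Arguments idm {p} X : rename.
Arguments comp {p X Y Z} g f : rename.

Notation "g \oc f" := (comp g f) : cat_scope.
Local Open Scope cat_scope.

Definition isomorphism (A : preadditiveCat) (X Y : A) (f : hom X Y) : Prop :=
  exists g : hom Y X, g \oc f = idm X /\ f \oc g = idm Y.

Definition monic (A : preadditiveCat) (X Y : A) (f : hom X Y) : Prop :=
  forall (T : A) (u v : hom T X), f \oc u = f \oc v -> u = v.

Definition epi (A : preadditiveCat) (X Y : A) (f : hom X Y) : Prop :=
  forall (T : A) (u v : hom Y T), u \oc f = v \oc f -> u = v.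

Definition initial (A : preadditiveCat) (Z : A) : Prop :=
  forall X : A, exists f : hom Z X, forall g : hom Z X, g = f.

Definition terminal (A : preadditiveCat) (Z : A) : Prop :=
  forall X : A, exists f : hom X Z, forall g : hom X Z, g = f.

Definition zero_object (A : preadditiveCat) (Z : A) : Prop :=
  initial Z /\ terminal Z.

Definition is_kernel (A : preadditiveCat) (X Y K : A)
    (f : hom X Y) (k : hom K X) : Prop :=
  f \oc k = 0 /\
  forall (T : A) (u : hom T X), f \oc u = 0 -> exists! v : hom T K, k \oc v = u.

Definition is_cokernel (A : preadditiveCat) (X Y Q : A)
    (f : hom X Y) (q : hom Y Q) : Prop :=
  q \oc f = 0 /\
  forall (T : A) (u : hom Y T), u \oc f = 0 -> exists! v : hom Q T, v \oc q = u.

Definition is_biproduct (A : preadditiveCat) (X Y S : A)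
    (i1 : hom X S) (i2 : hom Y S) (p1 : hom S X) (p2 : hom S Y) : Prop :=
  [/\ p1 \oc i1 = idm X, p2 \oc i2 = idm Y
    & i1 \oc p1 + i2 \oc p2 = idm S].

Record abelianCat := AbelianCat {
  preadd :> preadditiveCat;
  has_zero : exists Z : preadd, zero_object Z;
  has_biproducts : forall X Y : preadd,
    exists S (i1 : hom X S) (i2 : hom Y S) (p1 : hom S X) (p2 : hom S Y),
      is_biproduct i1 i2 p1 p2;
  has_kernels : forall (X Y : preadd) (f : hom X Y),
    exists K (k : hom K X), is_kernel f k;
  has_cokernels : forall (X Y : preadd) (f : hom X Y),
    exists Q (q : hom Y Q), is_cokernel f q;
  monic_normal : forall (X Y : preadd) (m : hom X Y), monic m ->
    exists Z (g : hom Y Z), is_kernel g m;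
  epi_conormal : forall (X Y : preadd) (e : hom X Y), epi e ->
    exists Z (g : hom Z X), is_cokernel g e
}.

Definition projective (A : preadditiveCat) (P : A) : Prop :=
  forall (X Y : A) (e : hom X Y) (f : hom P Y), epi e ->
    exists g : hom P X, e \oc g = f.

Definition enough_projectives (A : preadditiveCat) : Prop :=
  forall X : A, exists (P : A) (e : hom P X), projective P /\ epi e.

Lemma comp0m (A : preadditiveCat) (X Y Z : A) (f : hom X Y) :
  (0 : hom Y Z) \oc f = 0.
Proof. by apply: (addrI (0 \oc f)); rewrite -compDl !addr0. Qed.

Lemma compm0 (A : preadditiveCat) (X Y Z : A) (g : hom Y Z) :
  g \oc (0 : hom X Y) = 0.
Proof. by apply: (addrI (g \oc 0)); rewrite -compDr !addr0. Qed.

Definition zeroO (A : abelianCat) : A := sval (cid (has_zero A)).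

Definition Ker (A : abelianCat) (X Y : A) (f : hom X Y) : A :=
  sval (cid (has_kernels f)).

Definition ker (A : abelianCat) (X Y : A) (f : hom X Y) : hom (Ker f) X :=
  sval (cid (svalP (cid (has_kernels f)))).

Lemma kerP (A : abelianCat) (X Y : A) (f : hom X Y) : is_kernel f (ker f).
Proof. exact: (svalP (cid (svalP (cid (has_kernels f))))). Qed.

Definition Coker (A : abelianCat) (X Y : A) (f : hom X Y) : A :=
  sval (cid (has_cokernels f)).

Definition coker (A : abelianCat) (X Y : A) (f : hom X Y) : hom Y (Coker f) :=
  sval (cid (svalP (cid (has_cokernels f)))).

Lemma cokerP (A : abelianCat) (X Y : A) (f : hom X Y) :
  is_cokernel f (coker f).
Proof. exact: (svalP (cid (svalP (cid (has_cokernels f))))). Qed.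

Definition ker_lift (A : abelianCat) (X Y T : A) (f : hom X Y) (u : hom T X)
    (fu0 : f \oc u = 0) : hom T (Ker f) :=
  sval (cid ((kerP f).2 T u fu0)).

Lemma ker_liftK (A : abelianCat) (X Y T : A) (f : hom X Y) (u : hom T X)
    (fu0 : f \oc u = 0) : ker f \oc ker_lift fu0 = u.
Proof. exact: (svalP (cid ((kerP f).2 T u fu0))).1. Qed.

Definition coker_desc (A : abelianCat) (X Y T : A) (f : hom X Y) (u : hom Y T)
    (uf0 : u \oc f = 0) : hom (Coker f) T :=
  sval (cid ((cokerP f).2 T u uf0)).

Lemma coker_descK (A : abelianCat) (X Y T : A) (f : hom X Y) (u : hom Y T)
    (uf0 : u \oc f = 0) : coker_desc uf0 \oc coker f = u.
Proof. exact: (svalP (cid ((cokerP f).2 T u uf0))).1. Qed.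

Lemma ker_monic (A : abelianCat) (X Y : A) (f : hom X Y) : monic (ker f).
Proof.
move=> T u v uv; have [fk0 kU] := kerP f.
have [|w [_ wU]] := kU T (ker f \oc u); first by rewrite compA fk0 comp0m.
by rewrite -(wU u) // -(wU v).
Qed.

Definition Im (A : abelianCat) (X Y : A) (g : hom X Y) : A := Ker (coker g).

Definition im (A : abelianCat) (X Y : A) (g : hom X Y) : hom (Im g) Y :=
  ker (coker g).

Lemma im_comp0 (A : abelianCat) (X Y Z : A) (g : hom X Y) (f : hom Y Z) :
  f \oc g = 0 -> f \oc im g = 0.
Proof.
by move=> fg0; rewrite -(coker_descK fg0) -compA (kerP (coker g)).1 compm0.
Qed.

Definition im_to_ker (A : abelianCat) (X Y Z : A) (g : hom X Y) (f : hom Y Z)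
    (fg0 : f \oc g = 0) : hom (Im g) (Ker f) :=
  ker_lift (im_comp0 fg0).

Definition ker_mod_im (A : abelianCat) (X Y Z : A) (g : hom X Y) (f : hom Y Z)
    (fg0 : f \oc g = 0) : A :=
  Coker (im_to_ker fg0).

Lemma ker_map_subproof (A : abelianCat) (Y Z Y' Z' : A) (f : hom Y Z)
    (f' : hom Y' Z') (y : hom Y Y') (z : hom Z Z') :
  f' \oc y = z \oc f -> f' \oc (y \oc ker f) = 0.
Proof. by move=> yz; rewrite compA yz -compA (kerP f).1 compm0. Qed.

Definition ker_map (A : abelianCat) (Y Z Y' Z' : A) (f : hom Y Z)
    (f' : hom Y' Z') (y : hom Y Y') (z : hom Z Z')
    (yz : f' \oc y = z \oc f) : hom (Ker f) (Ker f') :=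
  ker_lift (ker_map_subproof yz).

Lemma ker_mod_im_map_subproof (A : abelianCat) (X Y Z X' Y' Z' : A)
    (g : hom X Y) (f : hom Y Z) (fg0 : f \oc g = 0)
    (g' : hom X' Y') (f' : hom Y' Z') (fg0' : f' \oc g' = 0)
    (x : hom X X') (y : hom Y Y') (z : hom Z Z')
    (xy : g' \oc x = y \oc g) (yz : f' \oc y = z \oc f) :
  (coker (im_to_ker fg0') \oc ker_map yz) \oc im_to_ker fg0 = 0.
Proof.
have yim0 : coker g' \oc (y \oc im g) = 0.
  rewrite compA; apply: im_comp0.
  by rewrite -compA -xy compA (cokerP g').1 comp0m.
have -> : coker (im_to_ker fg0') \oc ker_map yz \oc im_to_ker fg0 =
          coker (im_to_ker fg0') \oc (im_to_ker fg0' \oc ker_lift yim0).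
  rewrite -compA; congr (_ \oc _); apply: (@ker_monic _ _ _ f').
  rewrite !compA [ker f' \oc ker_map yz]ker_liftK.
  rewrite [ker f' \oc im_to_ker fg0']ker_liftK.
  by rewrite -compA [ker f \oc _]ker_liftK [im g' \oc _]ker_liftK.
by rewrite compA (cokerP (im_to_ker fg0')).1 comp0m.
Qed.

Definition ker_mod_im_map (A : abelianCat) (X Y Z X' Y' Z' : A)
    (g : hom X Y) (f : hom Y Z) (fg0 : f \oc g = 0)
    (g' : hom X' Y') (f' : hom Y' Z') (fg0' : f' \oc g' = 0)
    (x : hom X X') (y : hom Y Y') (z : hom Z Z')
    (xy : g' \oc x = y \oc g) (yz : f' \oc y = z \oc f) :
    hom (ker_mod_im fg0) (ker_mod_im fg0') :=
  coker_desc (ker_mod_im_map_subproof fg0 fg0' xy yz).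

(* The identity of [C i] seen as a morphism to [C j] when [i = j], and 0
   otherwise; it absorbs the propositional equalities between indices. *)
Definition idx (A : preadditiveCat) (C : int -> A) (i j : int) :
    hom (C i) (C j) :=
  match i =P j with
  | ReflectT ij => ecast k (hom (C i) (C k)) ij (idm (C i))
  | ReflectF _ => 0
  end.

(* [dpow d n i j] is the n-fold composite of consecutive [d]s from [C i] to
   [C j] if [j = i + n]. Only such [j] are used (otherwise it is 0); keeping
   [j] free avoids casts along identities such as [(j - b) + b = j]. *)
Fixpoint dpow (A : preadditiveCat) (C : int -> A)
    (d : forall i, hom (C i) (C (i + 1))) (n : nat) (i j : int) :
    hom (C i) (C j) :=
  match n with
  | 0%N => idx C i j
  | n'.+1 => dpow d n' (i + 1) j \oc d i
  end.

Record ncomplex (A : preadditiveCat) (N : nat) := NComplex {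
  cobj :> int -> A;
  diff : forall i, hom (cobj i) (cobj (i + 1));
  diffN0 : forall i, dpow diff N i (i + N%:Z) = 0
}.

Arguments diff {A N} c i : rename.

Record cmor (A : preadditiveCat) (N : nat) (C D : ncomplex A N) := CMor {
  cmap :> forall i, hom (C i) (D i);
  cmapE : forall i, cmap (i + 1) \oc diff C i = diff D i \oc cmap i
}.

Lemma idx_id (A : preadditiveCat) (C : int -> A) i : idx C i i = idm (C i).
Proof. by rewrite /idx; case: eqP => // e; rewrite (eq_axiomK e). Qed.

Lemma dpowD (A : preadditiveCat) (C : int -> A)
    (d : forall i, hom (C i) (C (i + 1))) (m n : nat) (i j k : int) :
  j = i + m%:Z -> dpow d (m + n) i k = dpow d n j k \oc dpow d m i j.
Proof.
move=> ->; elim: m i => [|m IHm] i /=; first by rewrite addr0 idx_id compm1.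
by rewrite compA IHm -addrA -intS.
Qed.

Lemma dpow_natural (A : preadditiveCat) (N : nat) (C D : ncomplex A N)
    (f : cmor C D) (n : nat) (i j : int) :
  dpow (diff D) n i j \oc f i = f j \oc dpow (diff C) n i j.
Proof.
elim: n i => [|n IHn] i /=; last by rewrite compA -IHn -!compA cmapE.
rewrite /idx; case: eqP => [ij|_]; last by rewrite comp0m compm0.
by case: j / ij; rewrite comp1m compm1.
Qed.

Definition conc_obj (A : abelianCat) (X : A) (i : int) : A :=
  if i == 0 then X else zeroO A.

Lemma conc_subproof (A : abelianCat) (N : nat) (N_gt0 : (0 < N)%N) (X : A)
    (i : int) :
  dpow (fun i => 0 : hom (conc_obj X i) (conc_obj X (i + 1))) N i (i + N%:Z)
  = 0.
Proof. by case: N N_gt0 => // N _ /=; rewrite compm0. Qed.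

Definition conc (A : abelianCat) (N : nat) (N_gt0 : (0 < N)%N) (X : A) :
    ncomplex A N :=
  NComplex (conc_subproof N_gt0 X).

Lemma dpow_ab0 (A : preadditiveCat) (a b : nat) (C : ncomplex A (a + b))
    (j : int) :
  dpow (diff C) a j (j + a%:Z) \oc dpow (diff C) b (j - b%:Z) j = 0.
Proof.
rewrite -dpowD ?subrK //.
have -> : j + a%:Z = (j - b%:Z) + (a + b)%N%:Z.
  by rewrite PoszD addrC [RHS]addrC -addrA [b%:Z + _]addrC subrK.
have dba m : m = (a + b)%N -> dpow (diff C) m (j - b%:Z)
    (j - b%:Z + (a + b)%N%:Z) = 0 by move=> ->; exact: diffN0.
by apply: dba; rewrite addnC.
Qed.

Definition homology (A : abelianCat) (a b : nat) (C : ncomplex A (a + b))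
    (j : int) : A :=
  ker_mod_im (dpow_ab0 C j).

Definition homology_map (A : abelianCat) (a b : nat)
    (C D : ncomplex A (a + b)) (f : cmor C D) (j : int) :
    hom (homology C j) (homology D j) :=
  ker_mod_im_map (dpow_ab0 C j) (dpow_ab0 D j)
    (dpow_natural f b (j - b%:Z) j) (dpow_natural f a j (j + a%:Z)).

Definition quasi_isomorphism (A : abelianCat) (a b : nat)
    (C D : ncomplex A (a + b)) (f : cmor C D) : Prop :=
  forall j : int, isomorphism (homology_map f j).

Definition projective_resolution (A : abelianCat) (a b : nat)
    (ab_gt0 : (0 < a + b)%N) (X : A) (P : ncomplex A (a + b)) : Prop :=
  [/\ forall i : int, 1 <= i -> zero_object (P i),
      forall i : int, i <= 0 -> projective (P i)
    & exists f : cmor P (conc ab_gt0 X), quasi_isomorphism f].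

(* Main.v *)
Require Import Defs.
From mathcomp Require Import all_boot all_order all_algebra.
From mathcomp Require Import boolp zify.
(* [all_algebra] shadows [hom]. *)
Import Defs.

(** Starting from an ordinary projective resolution [... -> R 1 -> R 0 -> X],
    put N = a + b and form the N-complex
    [... -> R 3 = ... = R 3 -> R 2 -> R 1 = ... = R 1 -> R 0], where each
    R (2k) occurs once, in degree - kN, and each R (2k + 1) occurs N - 1 times,
    connected by identities. A composite of N consecutive differentials ends in
    positive degree or crosses two differentials of R, hence vanishes. In any
    negative degree, either one of the maps d^a, d^b is an identity, or both
    are consecutive differentials of R; in each case the homology vanishes. In
    degree 0 it is the cokernel of R 1 -> R 0, that is X. *)

Set Implicit Arguments.
Unset Strict Implicit.
Unset Printing Implicit Defensive.

Import GRing.Theory Num.Theory.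
Local Open Scope ring_scope.
Local Open Scope cat_scope.

(** * Epimorphisms and zero objects in a preadditive category *)

Section Preadditive.
Variable A : preadditiveCat.

Lemma epi_comp_cancel (X Y Z : A) (g : hom Y Z) (f : hom X Y) :
  epi (g \oc f) -> epi g.
Proof. by move=> epi_gf T u v uv; apply: epi_gf; rewrite !compA uv. Qed.

Lemma epi_comp (X Y Z : A) (g : hom Y Z) (f : hom X Y) :
  epi g -> epi f -> epi (g \oc f).
Proof. by move=> eg ef T u v; rewrite !compA => /ef/eg. Qed.

Lemma epi_idm (X : A) : epi (idm X).
Proof. by move=> T u v; rewrite !compm1. Qed.

Lemma cokernel_epi (X Y Q : A) (f : hom X Y) (q : hom Y Q) :
  is_cokernel f q -> epi q.
Proof.
move=> [qf0 qU] T u v uv.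
have [|w [_ wU]] := qU T (u \oc q); first by rewrite -compA qf0 compm0.
by rewrite -(wU u) // -(wU v).
Qed.

Lemma idm0_zero_object (Z : A) : idm Z = 0 -> zero_object Z.
Proof.
move=> Z0; split=> X; exists 0 => g.
  by rewrite -[g]compm1 Z0 compm0.
by rewrite -[g]comp1m Z0 comp0m.
Qed.

Lemma hom_to_zero (X Z : A) (f : hom X Z) : zero_object Z -> f = 0.
Proof. by move=> [_ /(_ X)[g gU]]; rewrite (gU f) (gU 0). Qed.

Lemma zero_object_isomorphism (X Y : A) (f : hom X Y) :
  zero_object X -> zero_object Y -> isomorphism f.
Proof.
move=> X0 Y0; exists 0; split.
  by rewrite [LHS]hom_to_zero // [RHS]hom_to_zero.
by rewrite [LHS]hom_to_zero // [RHS]hom_to_zero.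
Qed.

End Preadditive.

(** * Exactness, cokernels and kernel-mod-image *)

Section Exactness.
Variable A : abelianCat.
Implicit Types X Y Z : A.

Lemma zeroO_zero : zero_object (zeroO A).
Proof. exact: (svalP (cid (has_zero A))). Qed.

(** Phrased by an epimorphism onto the kernel, the form that a projective covering [Ker f] supplies
    directly. *)
Definition exact_at X Y Z (g : hom X Y) (f : hom Y Z) : Prop :=
  exists2 e : hom X (Ker f), epi e & ker f \oc e = g.

Lemma exact_at_comp0 X Y Z (g : hom X Y) (f : hom Y Z) :
  exact_at g f -> f \oc g = 0.
Proof. by case=> e _ <-; rewrite compA (kerP f).1 comp0m. Qed.

Lemma exact_at_idml Y Z (f : hom Y Z) :
  f \oc idm Y = 0 -> exact_at (idm Y) f.
Proof.
move=> f0; exists (ker_lift f0); last exact: ker_liftK.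
apply: (@epi_comp_cancel _ _ _ _ _ (ker f)).
suff -> : ker_lift f0 \oc ker f = idm _ by apply: epi_idm.
by apply: (@ker_monic _ _ _ f); rewrite compA ker_liftK comp1m compm1.
Qed.

Lemma exact_at_ker0 X Y Z (g : hom X Y) (f : hom Y Z) :
  ker f = 0 -> g = 0 -> exact_at g f.
Proof.
move=> k0 ->; exists 0; last by rewrite compm0.
have K0 : idm (Ker f) = 0.
  by apply: (@ker_monic _ _ _ f); rewrite compm0 compm1 k0.
by move=> T u v _; rewrite -[u]compm1 -[v]compm1 K0 !compm0.
Qed.

Lemma exact_at_idmr X Y (g : hom X Y) :
  idm Y \oc g = 0 -> exact_at g (idm Y).
Proof.
rewrite comp1m => g0; apply: exact_at_ker0 => //.
by rewrite -[LHS]comp1m (kerP (idm Y)).1.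
Qed.

(** The epimorphism onto [Ker f] factors through [Im g], so [im_to_ker] is epi and its cokernel
    vanishes. *)
Lemma exact_at_ker_mod_im X Y Z (g : hom X Y) (f : hom Y Z)
    (fg0 : f \oc g = 0) :
  exact_at g f -> zero_object (ker_mod_im fg0).
Proof.
case=> e epi_e kfe; apply: idm0_zero_object.
have cg0 : coker g \oc g = 0 by have [] := cokerP g.
have fac : im_to_ker fg0 \oc ker_lift cg0 = e.
  apply: (@ker_monic _ _ _ f); rewrite kfe compA.
  by rewrite [ker f \oc im_to_ker fg0]ker_liftK [LHS]ker_liftK.
have epi_i : epi (im_to_ker fg0).
  by apply: (@epi_comp_cancel _ _ _ _ _ (ker_lift cg0)); rewrite fac.
have c0 : coker (im_to_ker fg0) = 0.
  by apply: epi_i; rewrite (cokerP (im_to_ker fg0)).1 comp0m.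
by apply: (cokernel_epi (cokerP (im_to_ker fg0))); rewrite comp1m comp0m.
Qed.

(** In an abelian category [f] is the cokernel of some [h]; this [h] factors through [ker f], which
    any [u] killing [g] kills too. *)
Lemma exact_at_cokernel X Y Z (g : hom X Y) (f : hom Y Z) :
  epi f -> exact_at g f -> is_cokernel g f.
Proof.
move=> epi_f ex; split; first exact: exact_at_comp0 ex.
case: ex => e epi_e kfe T u ug0.
have [W [h [fh0 fU]]] := epi_conormal epi_f.
have uk0 : u \oc ker f = 0.
  by apply: epi_e; rewrite comp0m -compA kfe.
by apply: fU; rewrite -(ker_liftK fh0) compA uk0 comp0m.
Qed.

Lemma im0 X Y : im (0 : hom X Y) = 0.
Proof.
have id0 : idm Y \oc (0 : hom X Y) = 0 by rewrite compm0.
rewrite -[LHS]comp1m -(coker_descK id0) -compA.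
by rewrite [coker _ \oc im _](kerP (coker 0)).1 compm0.
Qed.

(** Serves degree 0: both kernels are the whole middle objects, so the source is the cokernel of [g]
    and the target is [Y'], which [y] makes a cokernel of [g] as well. *)
Lemma ker_mod_im_map_cokernel X Y Z X' Y' Z' (g : hom X Y) (f : hom Y Z)
    (fg0 : f \oc g = 0) (g' : hom X' Y') (f' : hom Y' Z')
    (fg0' : f' \oc g' = 0) (x : hom X X') (y : hom Y Y') (z : hom Z Z')
    (xy : g' \oc x = y \oc g) (yz : f' \oc y = z \oc f) :
  f = 0 -> f' = 0 -> g' = 0 -> is_cokernel g y ->
  isomorphism (ker_mod_im_map fg0 fg0' xy yz).
Proof.
move=> f0 f'0 g'0 coky.
have fid : f \oc idm Y = 0 by rewrite f0 comp0m.
have fid' : f' \oc idm Y' = 0 by rewrite f'0 comp0m.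
pose s := ker_lift fid; pose s' := ker_lift fid'.
pose c := coker (im_to_ker fg0); pose c' := coker (im_to_ker fg0').
have ksE : ker f \oc s = idm Y by apply: ker_liftK.
have ks'E : ker f' \oc s' = idm Y' by apply: ker_liftK.
have skE : s \oc ker f = idm _.
  by apply: (@ker_monic _ _ _ f); rewrite compA ksE comp1m compm1.
have s'kE : s' \oc ker f' = idm _.
  by apply: (@ker_monic _ _ _ f'); rewrite compA ks'E comp1m compm1.
have csg0 : (c \oc s) \oc g = 0.
  have cg0 : coker g \oc g = 0 by have [] := cokerP g.
  have gE : ker f \oc (im_to_ker fg0 \oc ker_lift cg0) = g.
    by rewrite compA [ker f \oc im_to_ker fg0]ker_liftK; apply: ker_liftK.
  suff : (c \oc s) \oc (ker f \oc (im_to_ker fg0 \oc ker_lift cg0)) = 0.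
    by rewrite gE.
  rewrite compA -[c \oc s \oc _]compA skE compm1 compA.
  by rewrite (cokerP (im_to_ker fg0)).1 comp0m.
(* [c \oc s] kills [g], so it descends along [y]; the resulting [t] induces the inverse. *)
have [t [ty _]] := coky.2 _ _ csg0.
have tk0 : (t \oc ker f') \oc im_to_ker fg0' = 0.
  rewrite -compA [ker f' \oc im_to_ker _]ker_liftK.
  by rewrite (_ : im g' = 0) ?compm0 // g'0 im0.
have kmE : ker f' \oc ker_map yz = y \oc ker f by apply: ker_liftK.
have mapE : ker_mod_im_map fg0 fg0' xy yz \oc c = c' \oc ker_map yz.
  exact: coker_descK.
have invE : coker_desc tk0 \oc c' = t \oc ker f' by apply: coker_descK.
exists (coker_desc tk0); split.
  apply: (cokernel_epi (cokerP (im_to_ker fg0))).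
  rewrite -compA mapE compA invE -compA kmE compA ty -compA skE.
  by rewrite comp1m compm1.
apply: (cokernel_epi (cokerP (im_to_ker fg0'))).
have epi_yk : epi (y \oc ker f).
  apply: epi_comp; first exact: cokernel_epi coky.
  by apply: (@epi_comp_cancel _ _ _ _ _ s); rewrite ksE; apply: epi_idm.
have epi_k : epi (ker_map yz).
  have -> : ker_map yz = s' \oc (y \oc ker f).
    by rewrite -kmE compA s'kE comp1m.
  apply: epi_comp => //.
  by apply: (@epi_comp_cancel _ _ _ _ _ (ker f')); rewrite s'kE; apply: epi_idm.
apply: epi_k; rewrite -[_ \oc _ \oc c']compA invE comp1m -mapE.
by rewrite -!compA kmE [t \oc _]compA ty -compA skE compm1.
Qed.

End Exactness.

(** * Ordinary projective resolutions *)

Section Resolution.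
Variables (A : abelianCat) (enough : enough_projectives A).

Lemma projective_cover_ker (Y Z : A) (h : hom Y Z) :
  exists P (f : hom P Y), projective P /\ exact_at f h.
Proof.
have [P [e [prP epi_e]]] := enough (Ker h).
by exists P, (ker h \oc e); split => //; exists e.
Qed.

Lemma exists_projective_resolution (X : A) :
  exists (R : nat -> A) (d : forall n, hom (R n.+1) (R n))
      (eps : hom (R 0%N) X),
    [/\ forall n, projective (R n), epi eps, exact_at (d 0%N) eps
      & forall n, exact_at (d n.+1) (d n)].
Proof.
pose arrow := {Z : A & {Y : A & hom Y Z}}.
pose src (s : arrow) := projT1 (projT2 s).
pose map (s : arrow) : hom (src s) (projT1 s) := projT2 (projT2 s).
have next (s : arrow) :
    {P & {f : hom P (src s) | projective P /\ exact_at f (map s)}}.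
  by have /cid[P /cid[f ?]] := projective_cover_ker (map s); exists P, f.
have [P [e [prP epi_e]]] := enough X.
(* Packing an arrow with its ends makes the construction a plain iteration; the target of [step s]
   is [src s] by computation, so consecutive differentials compose without casts. *)
pose step s : arrow :=
  existT _ (src s) (existT _ (projT1 (next s)) (sval (projT2 (next s)))).
pose st n := iter n step (existT _ X (existT _ P e)).
exists (fun n => src (st n)), (fun n => map (st n.+1)), e; split=> //.
- by case=> [|n] //; case: (svalP (projT2 (next (st n)))).
- by case: (svalP (projT2 (next (st 0%N)))).
- by move=> n; case: (svalP (projT2 (next (st n.+1)))).
Qed.

End Resolution.

(** * Composites of differentials in a chain complex *)

Section Transition.
Variable A : preadditiveCat.

(* The composite [Q m -> Q n] of differentials of a complex [Q]: the identity
   if [m = n], [d n] if [m = n.+1], and 0 otherwise. Shifting [Q] in the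
   recursive call avoids casts. *)
Fixpoint transition (Q : nat -> A) (d : forall n, hom (Q n.+1) (Q n))
    (m n : nat) {struct n} : hom (Q m) (Q n) :=
  match n, m with
  | 0, 0 => idm (Q 0%N)
  | 0, 1 => d 0%N
  | n'.+1, m'.+1 => @transition (fun k => Q k.+1) (fun k => d k.+1) m' n'
  | _, _ => 0
  end.

Lemma transition_id (Q : nat -> A) d n : @transition Q d n n = idm (Q n).
Proof.
elim: n Q d => [|n IHn] Q d //.
exact: (IHn (fun k => Q k.+1) (fun k => d k.+1)).
Qed.

Lemma transition1 (Q : nat -> A) d n : @transition Q d n.+1 n = d n.
Proof.
elim: n Q d => [|n IHn] Q d //.
exact: (IHn (fun k => Q k.+1) (fun k => d k.+1)).
Qed.

Lemma transition_far (Q : nat -> A) d m n :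
  (n.+1 < m)%N -> @transition Q d m n = 0.
Proof.
elim: n m Q d => [|n IHn] [|[|m]] Q d // lt_nm.
exact: (IHn m.+1 (fun k => Q k.+1) (fun k => d k.+1)).
Qed.

(** If [m <= p.+1], one factor is an identity. Otherwise both sides vanish, by [dd0] or because some
    transition skips a term. *)
Lemma transition_comp (Q : nat -> A) (d : forall n, hom (Q n.+1) (Q n)) m n p :
  (forall k, d k \oc d k.+1 = 0) -> (p <= n <= m)%N ->
  transition d n p \oc transition d m n = transition d m p.
Proof.
elim: p m n Q d => [|p IHp] m n Q d dd0 /andP[le_pn le_nm]; last first.
  case: n le_pn le_nm => [//|n] le_pn; case: m => [//|m] le_nm.
  apply: (IHp m n (fun k => Q k.+1) (fun k => d k.+1)) => //.
  exact/andP.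
case: n le_nm le_pn => [|[|n]] le_nm _; first by rewrite transition_id comp1m.
  case: m le_nm => [|[|m]] // _.
    by rewrite [transition d 1 1]transition_id compm1.
  case: m => [|m]; first by rewrite !transition1 dd0 transition_far.
  by rewrite (transition_far d (m := m.+3) (n := 1)) // compm0 transition_far.
by rewrite !(@transition_far _ _ _ 0) ?comp0m //; case: m le_nm => [|[]].
Qed.

End Transition.

(** * Arithmetic of the degrees *)

Section Stretch.
Local Open Scope nat_scope.
Variable N : nat.

(* The term placed in degree [i], numbered so that 0 stands for the zero object
   and [k.+1] for [R k]; at [i = - m] it is
   [1 + floor (m / N) + ceil (m / N)]. *)
Definition stretch (i : int) : nat :=
  match i with
  | Posz n => n == 0
  | Negz m => (m.+1 %/ N + m %/ N).+2
  end.

Lemma stretch_pos (i : int) : (0 < i)%R -> stretch i = 0.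
Proof. by case: i => [[|n]|m]. Qed.

Lemma stretch_gt0 (i : int) : (i <= 0)%R -> 0 < stretch i.
Proof. by case: i => [[|n]|m]. Qed.

Lemma stretch_mul (k : nat) : 0 < N -> stretch (- (k * N)%:Z) = k.*2.+1.
Proof.
move=> N_gt0; case: k => [|k] //.
have -> : (- (k.+1 * N)%:Z = Negz (k * N + N.-1))%R by lia.
rewrite /= (_ : (k * N + N.-1).+1 = k.+1 * N); last by lia.
by rewrite mulnK // divnMDl // divn_small; lia.
Qed.

Lemma stretch_mulD (k r : nat) :
  0 < r < N -> stretch (- (k * N + r)%:Z) = k.*2.+2.
Proof.
case: r => [|r] // /andP[_ lt_rN].
have -> : (- (k * N + r.+1)%:Z = Negz (k * N + r))%R by lia.
by rewrite /= -[(k * N + r).+1]addnS !divnMDl ?divn_small; lia.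
Qed.

(** Both degrees have the same remainder mod [N] and quotients differing by one. The drop by two is
    what forces [d^N = 0]. *)
Lemma stretch_shift (i : int) : 0 < N ->
  stretch (i + N%:Z) = 0 \/ stretch i = (stretch (i + N%:Z)).+2.
Proof.
move=> N_gt0; have [i_gt|i_le] := ltrP 0 (i + N%:Z)%R.
  by left; apply: stretch_pos.
right; pose m := `|(i + N%:Z)%R|%N.
rewrite (_ : (i + N%:Z)%R = (- m%:Z)%R); last by lia.
have -> : (i = - (m + N)%:Z)%R by lia.
rewrite (divn_eq m N); case: (posnP (m %% N)) => [->|r_gt0].
  by rewrite addn0 -mulSnr !stretch_mul.
have rN : 0 < m %% N < N by rewrite r_gt0 ltn_mod.
by rewrite addnAC -mulSnr !stretch_mulD.
Qed.

Lemma stretch_succ (i : int) : stretch (i + 1) <= stretch i.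
Proof.
case: i => [n|[|m]] //; first by rewrite stretch_pos; lia.
have -> : (Negz m.+1 + 1 = Negz m)%R by lia.
by rewrite /= !ltnS leq_add // leq_div2r.
Qed.

End Stretch.

Lemma stretch_cases (a b : nat) (j : int) : (0 < a)%N -> (0 < b)%N -> j != 0 ->
  let q := stretch (a + b) in
  [\/ q (j - b%:Z) = q j, q (j + a%:Z) = q j
    | exists k, [/\ q (j + a%:Z) = k.+1, q j = k.+2 & q (j - b%:Z) = k.+3]].
Proof.
move=> a_gt0 b_gt0 j_neq0.
have: (a + b)%N = (a + b)%N by []; move: {2 3}(a + b)%N => N abN /=.
have [j_gt0|j_le0] := ltrP 0 j.
  by constructor 2; rewrite !stretch_pos //; lia.
have N_gt0 : (0 < N)%N by lia.
pose k := (`|j| %/ N)%N; pose r := (`|j| %% N)%N.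
have jE : j = - (k * N + r)%:Z.
  by rewrite -divn_eq; lia.
have r_lt : (r < N)%N by rewrite ltn_mod.
have [r0|r_gt0] := posnP r.
  (* At remainder 0 the term occurs in this degree only. Since [a + b = N], moving up by [a] or down
     by [b] gives remainder [b], hence the two adjacent odd terms. *)
  constructor 3; have k_gt0 : (0 < k)%N.
    by rewrite lt0n; apply/eqP => k0; move: j_neq0; rewrite jE r0 k0.
  case: k k_gt0 jE => [//|k] _ jE.
  exists k.*2.+1; rewrite jE r0; split.
  - rewrite (_ : _ + _ = - (k * N + b)%:Z) ?stretch_mulD //; lia.
  - by rewrite addn0 stretch_mul.
  - rewrite (_ : _ - _ = - (k.+1 * N + b)%:Z) ?stretch_mulD //; lia.
have qj : stretch N j = k.*2.+2 by rewrite jE stretch_mulD //; lia.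
(* Inside a block of equal terms: [d^b] starts in the block if [r < a], [d^a] ends in it if [r > a],
   and for [r = a] both outer degrees are multiples of [N]. *)
have [r_lta|r_gta|r_eqa] := ltngtP r a.
- constructor 1; rewrite qj jE.
  rewrite (_ : _ - _ = - (k * N + (r + b))%:Z) ?stretch_mulD //; lia.
- constructor 2; rewrite qj jE.
  rewrite (_ : _ + _ = - (k * N + (r - a))%:Z) ?stretch_mulD //; lia.
- constructor 3; exists k.*2; rewrite qj jE; split=> //.
    rewrite (_ : _ + _ = - (k * N)%:Z) ?stretch_mul //; lia.
  rewrite (_ : _ - _ = - (k.+1 * N)%:Z) ?stretch_mul //; lia.
Qed.

(** * The stretched complex and its augmentation *)

Section StretchedComplex.
Variables (A : abelianCat) (N : nat) (N_gt0 : (0 < N)%N).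
Variables (R : nat -> A) (d : forall n, hom (R n.+1) (R n)).
Hypothesis d_exact : forall n, exact_at (d n.+1) (d n).

Definition augment (n : nat) : A := if n is k.+1 then R k else zeroO A.

Definition augment_diff (n : nat) : hom (augment n.+1) (augment n) :=
  if n is k.+1 then d k else 0.

Definition stretch_diff (i : int) :
    hom (augment (stretch N i)) (augment (stretch N (i + 1))) :=
  transition augment_diff (stretch N i) (stretch N (i + 1)).

Lemma augment_diff0 n : augment_diff n \oc augment_diff n.+1 = 0.
Proof.
case: n => [|n] /=; first by rewrite comp0m.
exact: exact_at_comp0 (d_exact n).
Qed.

Lemma stretch_shift_le (n : nat) (i : int) :
  (stretch N (i + n%:Z) <= stretch N i)%N.
Proof.
elim: n => [|n IHn]; first by rewrite addr0.
by apply: leq_trans IHn; rewrite intS [1 + _]addrC addrA stretch_succ.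
Qed.

(** Indices only decrease as the degree grows, so [transition_comp] absorbs one differential at a
    time. Powers of [d] then depend on two indices alone. *)
Lemma dpow_stretch (n : nat) (i j : int) : j = i + n%:Z ->
  dpow stretch_diff n i j = transition augment_diff (stretch N i) (stretch N j).
Proof.
elim: n i => [|n IHn] i jE /=.
  by rewrite jE addr0 (idx_id (fun k => augment (stretch N k))) transition_id.
have jE' : j = i + 1 + n%:Z by rewrite jE intS addrA.
rewrite IHn // transition_comp ?stretch_succ ?andbT //.
  exact: augment_diff0.
by rewrite jE' stretch_shift_le.
Qed.

Lemma stretch_diffN0 (i : int) : dpow stretch_diff N i (i + N%:Z) = 0.
Proof.
rewrite dpow_stretch //; case: (stretch_shift i N_gt0) => [q0|->].
  by apply: hom_to_zero; rewrite q0; apply: zeroO_zero.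
exact: transition_far.
Qed.

Definition stretched : ncomplex A N := NComplex stretch_diffN0.

Lemma stretched_zero (i : int) : 0 < i -> zero_object (stretched i).
Proof.
by move=> i_gt0; rewrite /= /augment stretch_pos //; apply: zeroO_zero.
Qed.

(** When one map is an identity, the zero composite forces the other to be 0. Free indices allow the
    equations to be substituted. *)
Lemma exact_transition (u v w : nat) :
  transition augment_diff v w \oc transition augment_diff u v = 0 ->
  [\/ u = v, w = v | exists k, [/\ w = k.+1, v = k.+2 & u = k.+3]] ->
  exact_at (transition augment_diff u v) (transition augment_diff v w).
Proof.
move=> vw0 [uv|wv|[k [wk vk uk]]]; subst.
- by rewrite transition_id in vw0 *; apply: exact_at_idml.
- by rewrite transition_id in vw0 *; apply: exact_at_idmr.
- by rewrite !transition1; apply: d_exact.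
Qed.

Variables (X : A) (eps : hom (R 0%N) X).
Hypotheses (eps_epi : epi eps) (eps_exact : exact_at (d 0%N) eps).

Definition augment_eps (n : nat) : hom (augment n) X :=
  if n is 1%N then eps else 0.

(** The return clause repeats the test in [conc_obj], giving target [X] in degree 0 without a
    cast. *)
Definition stretched_eps (i : int) : hom (stretched i) (conc_obj X i) :=
  if i == 0 as b return hom (stretched i) (if b then X else zeroO A)
  then augment_eps (stretch N i) else 0.

Lemma augment_eps_cokernel (u v : nat) : u = 2%N -> v = 1%N ->
  is_cokernel (transition augment_diff u v) (augment_eps v).
Proof. by move=> -> ->; apply: exact_at_cokernel. Qed.

Lemma stretched_eps_neq0 (i : int) : i != 0 -> stretched_eps i = 0.
Proof.
move=> /negbTE i_neq0; apply: hom_to_zero.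
by rewrite /conc_obj i_neq0; apply: zeroO_zero.
Qed.

Lemma stretched_epsE (N_gt1 : (1 < N)%N) (i : int) :
  stretched_eps (i + 1) \oc diff stretched i =
    diff (conc N_gt0 X) i \oc stretched_eps i.
Proof.
rewrite [RHS]comp0m; have [i1|i1] := eqVneq (i + 1) 0; last first.
  by rewrite stretched_eps_neq0 // comp0m.
(* As [N > 1], degree -1 carries [R 1], and the claim becomes [eps \oc d 0 = 0]. *)
have -> : i = -1 by lia.
apply: (augment_eps_cokernel _ _).1 => //.
by rewrite /= div0n divn_small.
Qed.

Definition stretched_augmentation (N_gt1 : (1 < N)%N) :
    cmor stretched (conc N_gt0 X) :=
  @CMor A N stretched (conc N_gt0 X) stretched_eps (stretched_epsE N_gt1).

End StretchedComplex.

(** * The augmentation as a quasi-isomorphism *)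

Lemma dpow0 (A : preadditiveCat) (C : int -> A) (n : nat) (i j : int) :
  (0 < n)%N -> dpow (fun i => 0 : hom (C i) (C (i + 1))) n i j = 0.
Proof. by case: n => // n _ /=; rewrite compm0. Qed.

Lemma stretched_quasi_isomorphism (A : abelianCat) (a b : nat)
    (a_gt0 : (0 < a)%N) (b_gt0 : (0 < b)%N) (ab_gt0 : (0 < a + b)%N)
    (ab_gt1 : (1 < a + b)%N) (R : nat -> A) (d : forall n, hom (R n.+1) (R n))
    (d_exact : forall n, exact_at (d n.+1) (d n)) (X : A) (eps : hom (R 0%N) X)
    (eps_epi : epi eps) (eps_exact : exact_at (d 0%N) eps) :
  quasi_isomorphism
    (stretched_augmentation ab_gt0 d_exact eps_epi eps_exact ab_gt1).
Proof.
move=> j; have [->|j_neq0] := eqVneq j 0.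
  (* [d^a] lands in positive degree, hence is 0; [d^b] starts in degree [-b], which carries [R 1]
     because [0 < b < a + b]. *)
  apply: ker_mod_im_map_cokernel; [| exact: dpow0 | exact: dpow0 |].
    by apply: hom_to_zero; apply: stretched_zero; lia.
  rewrite [dpow _ _ _ _]dpow_stretch ?subrK //.
  apply: augment_eps_cokernel => //.
  by rewrite (_ : _ - _ = - (0 * (a + b) + b)%N%:Z) ?stretch_mulD //; lia.
(* Away from degree 0 both homology objects vanish. *)
apply: zero_object_isomorphism; apply: exact_at_ker_mod_im.
  have := dpow_ab0 (stretched ab_gt0 d_exact) j.
  rewrite /= !dpow_stretch ?subrK // => dd0.
  by apply: exact_transition => //; apply: stretch_cases.
apply: exact_at_ker0; last exact: dpow0.
have Y0 : zero_object (conc_obj X j).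
  by rewrite /conc_obj (negbTE j_neq0); apply: zeroO_zero.
exact: hom_to_zero.
Qed.

Theorem corollary13 (A : abelianCat) (a b : nat)
    (a_gt0 : (0 < a)%N) (b_gt0 : (0 < b)%N)
    (enough : enough_projectives A) (X : A) :
  exists P : ncomplex A (a + b),
    projective_resolution (ltn_addr b a_gt0) X P.
Proof.
have [R [d [eps [prR eps_epi eps_exact d_exact]]]] :=
  exists_projective_resolution enough X.
have ab_gt1 : (1 < a + b)%N by lia.
exists (stretched (ltn_addr b a_gt0) d_exact); split.
- by move=> i i_ge1; apply: stretched_zero; lia.
- move=> i /(stretch_gt0 (a + b)) /=.
  by case: (stretch _ i) => // k _; apply: prR.
exists (stretched_augmentation _ d_exact eps_epi eps_exact ab_gt1).
exact: stretched_quasi_isomorphism.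
Qed.
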